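(* The generating function $G_4(x)=\sum_{n\ge0}g_{4,n}x^n$ for Greek key tours on height $4$ grid graphs is $$G_4(x)=\frac{1-2x-2x^2+11x^3+4x^4-10x^5+4x^6+2x^7-3x^8+x^9}{(1-x-3x^2-x^3+x^4)(1-2x-2x^2+2x^3-x^4)}.$$
   Context: A Greek key tour on the $k\times n$ grid graph ($k$ rows, $n$ columns; vertices are integer points, edges join points at distance $1$) is a directed self-avoiding walk that starts at the upper-left corner vertex and visits every vertex of the grid exactly once. $g_{k,n}$ denotes the number of Greek key tours on the $k\times n$ grid graph, with the convention $g_{k,0}=1$. *)

(* Defs.v *)
From HB Require Import structures.
From mathcomp Require Import all_boot all_order all_algebra.
From mathcomp Require Import boolp.

Set Implicit Arguments.
Unset Strict Implicit.
Unset Printing Implicit Defensive.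

Import GRing.Theory.

(** * Greek key tours *)

(* A vertex is a pair (row, column), with rows numbered from top to bottom and
   columns from left to right, so that the upper-left corner is (0, 0). *)
Definition vertex (k n : nat) : finType := ('I_k * 'I_n)%type.

(* Here `|a - b| is the absolute difference of natural numbers, so this says
   that the Euclidean distance is 1. *)
Definition grid_adj (k n : nat) : rel (vertex k n) :=
  fun u v => (`|u.1 - v.1| ^ 2 + `|u.2 - v.2| ^ 2 == 1)%N.

Definition upper_left (k n : nat) : pred (vertex k n) :=
  fun u => (u.1 == 0 :> nat) && (u.2 == 0 :> nat).

Definition greek_key_tour (k n : nat) (s : seq (vertex k n)) : bool :=
  if s is u :: p then
    [&& upper_left u, path (@grid_adj k n) u p, uniq s
      & [forall v : vertex k n, v \in s]]
  else false.

(* A tour lists each of the k * n vertices once, so restricting to sequences of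
   length k * n loses no tour. *)
Definition greek_key (k n : nat) : nat :=
  if n == 0 then 1
  else #|[set t : (k * n).-tuple (vertex k n) | greek_key_tour t]|.

(** * The ring of formal power series in one variable *)

Local Open Scope ring_scope.

Record fps (R : Type) : Type := Fps { fps_coef : nat -> R }.

Lemma fpsP (R : Type) (f g : fps R) : fps_coef f =1 fps_coef g -> f = g.
Proof. by case: f g => [f] [g] /= /funext ->. Qed.

HB.instance Definition _ (R : Type) := gen_eqMixin (fps R).
HB.instance Definition _ (R : Type) := gen_choiceMixin (fps R).

Section FpsRing.
Variable R : comUnitRingType.
Implicit Types f g h : fps R.

Definition fps_zero : fps R := Fps (fun=> 0).
Definition fps_opp f : fps R := Fps (fun n => - fps_coef f n).
Definition fps_add f g : fps R := Fps (fun n => fps_coef f n + fps_coef g n).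

Fact fps_addA : associative fps_add.
Proof. by move=> f g h; apply: fpsP => n /=; rewrite addrA. Qed.
Fact fps_addC : commutative fps_add.
Proof. by move=> f g; apply: fpsP => n /=; rewrite addrC. Qed.
Fact fps_add0 : left_id fps_zero fps_add.
Proof. by move=> f; apply: fpsP => n /=; rewrite add0r. Qed.
Fact fps_addN : left_inverse fps_zero fps_opp fps_add.
Proof. by move=> f; apply: fpsP => n /=; rewrite addNr. Qed.

HB.instance Definition _ := GRing.isZmodule.Build (fps R)
  fps_addA fps_addC fps_add0 fps_addN.

Definition fps_one : fps R := Fps (fun n => (n == 0)%:R).
Definition fps_mul f g : fps R :=
  Fps (fun n => \sum_(i < n.+1) fps_coef f i * fps_coef g (n - i)).

Let trunc n f : {poly R} := \poly_(i < n) fps_coef f i.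

Let coef_trunc n f i : (i < n)%N -> (trunc n f)`_i = fps_coef f i.
Proof. by move=> lt_in; rewrite coef_poly lt_in. Qed.

Let coef_mul n f g i : (i < n)%N ->
  fps_coef (fps_mul f g) i = (trunc n f * trunc n g)`_i.
Proof.
move=> lt_in; rewrite coefM; apply: eq_bigr => j _.
rewrite !coef_trunc //; first by rewrite (leq_ltn_trans (leq_subr _ _)).
by rewrite (leq_trans (ltn_ord j)).
Qed.

Fact fps_mulC : commutative fps_mul.
Proof.
by move=> f g; apply: fpsP => n; rewrite !(@coef_mul n.+1) // mulrC.
Qed.

Fact fps_mulA : associative fps_mul.
Proof.
move=> f g h; apply: fpsP => n.
transitivity ((trunc n.+1 f * (trunc n.+1 g * trunc n.+1 h))`_n).
  rewrite (@coef_mul n.+1) // coefM [RHS]coefM; apply: eq_bigr => i _.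
  have lt_ni : (n - i < n.+1)%N by rewrite ltnS leq_subr.
  by rewrite [in LHS](coef_trunc (fps_mul g h) lt_ni) (coef_mul g h lt_ni).
rewrite mulrA [RHS](@coef_mul n.+1) // coefM [RHS]coefM.
apply: eq_bigr => i _.
by rewrite (coef_trunc (fps_mul f g) (ltn_ord i)) (coef_mul f g (ltn_ord i)).
Qed.

Fact fps_mul1 : left_id fps_one fps_mul.
Proof.
move=> f; apply: fpsP => n /=; rewrite big_ord_recl /= mul1r subn0.
by rewrite big1 ?addr0 // => i _; rewrite mul0r.
Qed.

Fact fps_mulDl : left_distributive fps_mul fps_add.
Proof.
move=> f g h; apply: fpsP => n /=; rewrite -big_split /=.
by apply: eq_bigr => i _; rewrite mulrDl.
Qed.

Fact fps_one_neq0 : fps_one != 0.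
Proof.
apply/eqP => /(congr1 (fun f => fps_coef f 0%N)) /= /eqP.
by rewrite oner_eq0.
Qed.

HB.instance Definition _ := GRing.Zmodule_isComNzRing.Build (fps R)
  fps_mulA fps_mulC fps_mul1 fps_mulDl fps_one_neq0.

(* The first n coefficients of the inverse: solving f * g = 1 for the m-th
   coefficient of g gives
     g_m = f_0^-1 * ((m == 0) - \sum_(i < m) f_(m - i) * g_i). *)
Fixpoint fps_inv_seq f n : seq R :=
  if n is m.+1 then
    let s := fps_inv_seq f m in
    rcons s ((fps_coef f 0)^-1 *
             ((m == 0)%:R - \sum_(i < m) fps_coef f (m - i) * s`_i))
  else [::].

Definition fps_unit : pred (fps R) :=
  fun f => fps_coef f 0 \is a GRing.unit.

(* As for every unitRingType, the inverse of a non-unit is itself. *)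
Definition fps_inv f : fps R :=
  if fps_unit f then Fps (fun n => (fps_inv_seq f n.+1)`_n) else f.

Let size_inv_seq f n : size (fps_inv_seq f n) = n.
Proof. by elim: n => //= n IHn; rewrite size_rcons IHn. Qed.

Let nth_inv_seq f n i : (i < n)%N ->
  (fps_inv_seq f n)`_i = (fps_inv_seq f i.+1)`_i.
Proof.
elim: n => // n IHn; rewrite ltnS leq_eqVlt => /predU1P[-> // | lt_in].
by rewrite [LHS]/= nth_rcons size_inv_seq lt_in IHn.
Qed.

Let last_inv_seq f n : (fps_inv_seq f n.+1)`_n =
  (fps_coef f 0)^-1 * ((n == 0)%:R
    - \sum_(i < n) fps_coef f (n - i) * (fps_inv_seq f i.+1)`_i).
Proof.
rewrite [LHS]/= nth_rcons size_inv_seq ltnn eqxx; congr (_ * (_ - _)).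
by apply: eq_bigr => i _; rewrite (nth_inv_seq f (ltn_ord i)).
Qed.

Fact fps_mulV : {in fps_unit, left_inverse 1 fps_inv *%R}.
Proof.
move=> f Uf; rewrite /fps_inv; have Uf0 : fps_unit f by [].
rewrite Uf0; apply: fpsP => n.
change (\sum_(i < n.+1) (fps_inv_seq f i.+1)`_i * fps_coef f (n - i)
        = (n == 0)%:R).
have := last_inv_seq f n.
pose g i := (fps_inv_seq f i.+1)`_i; rewrite -/(g n) => def_gn.
rewrite (eq_bigr (fun i : 'I_n.+1 => fps_coef f (n - i) * g i)); last first.
  by move=> i _; rewrite mulrC.
by rewrite big_ord_recr /= subnn def_gn mulVKr // addrC subrK.
Qed.

Fact fps_unitPl f g : g * f = 1 -> fps_unit f.
Proof.
move/(congr1 (fun h => fps_coef h 0%N)) => /=.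
rewrite big_ord_recl big_ord0 addr0 /= => gf1.
by apply/unitrPr; exists (fps_coef g 0); rewrite mulrC.
Qed.

Fact fps_inv_out : {in [predC fps_unit], fps_inv =1 id}.
Proof. by move=> f /negbTE nUf; rewrite /fps_inv [fps_unit f]nUf. Qed.

HB.instance Definition _ := GRing.ComNzRing_hasMulInverse.Build (fps R)
  fps_mulV fps_unitPl fps_inv_out.

Definition fpsX : fps R := Fps (fun n => (n == 1)%:R).

End FpsRing.

(** * The generating function *)

Definition greek_key_gf (k : nat) : fps int :=
  Fps (fun n => (greek_key k n)%:Z).

(* Main.v *)
Require Import Defs.
From mathcomp Require Import all_boot all_order all_algebra.
From mathcomp Require Import zify ring ssrZ.
From Stdlib Require BinInt.

Set Implicit Arguments.
Unset Strict Implicit.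
Unset Printing Implicit Defensive.

Import GRing.Theory.

(** Adjoin to the 4 x n grid a start site, joined to the upper-left corner only,
and a stop site, adjacent to every vertex, so that tours become Hamiltonian
paths from start to stop.  Delete the vertices one by one: if the path passes
u - v - w, then deleting v leaves a path in which u and w are consecutive, and
this link {u, w} is remembered as mandatory.  Conversely v can be reinserted
between u and w in exactly one way, so the number of paths with a given set M of
mandatory links is the sum, over the admissible pairs {u, w} of neighbours of v,
of the numbers of paths avoiding v with {u, w} added to M; neither planarity
nor a bookkeeping of components is needed.  Deleting the four vertices of the
first column turns the count for n + 2 columns into a sum of counts for n + 1
columns.  Only 90 sets of links on the first column arise from the initial one,
and the 90 resulting counting sequences, being related by this transfer matrix,
all satisfy the recurrence given by the denominator as soon as they do so once,
which is a finite check, as are the coefficients of the numerator. *)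

(** * Paths with mandatory links *)

Section UnorderedPairs.
Variable T : eqType.
Implicit Types (s : seq T) (p : T * T).

Fixpoint upairs s : seq (T * T) :=
  if s is x :: s' then [seq (x, y) | y <- s'] ++ upairs s' else [::].

Definition swap p := (p.2, p.1).

Lemma mem_upairs s p : p \in upairs s -> (p.1 \in s) && (p.2 \in s).
Proof.
elim: s => //= x s IHs; rewrite mem_cat !inE => /orP[/mapP[y ys ->]|/IHs/andP[-> ->]].
  by rewrite eqxx ys orbT.
by rewrite !orbT.
Qed.

Lemma upairs_uniq s : uniq s -> uniq (upairs s).
Proof.
elim: s => //= x s IHs /andP[xs us]; rewrite cat_uniq IHs // andbT.
rewrite map_inj_uniq ?us //; last by move=> ? ? [].
apply/hasPn => p /mem_upairs/andP[p1 _]; apply: contra xs => /mapP[y _ ep].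
by rewrite ep in p1.
Qed.

(** Exactly one orientation of each pair of distinct entries is listed, so summing over [upairs]
    counts every unordered pair once. *)
Lemma upairs_swap s p : uniq s -> p.1 != p.2 -> p.1 \in s -> p.2 \in s ->
  (swap p \in upairs s) = (p \notin upairs s).
Proof.
case: p => x y /=; elim: s => //= z s IHs /andP[zs us] nxy.
have mapE a b : ((a, b) \in [seq (z, y) | y <- s]) = (a == z) && (b \in s).
  apply/mapP/andP => [[c cs [-> ->]] | [/eqP-> bs]]; first by rewrite eqxx.
  by exists b.
have nz a b : a == z -> ((a, b) \in upairs s) || ((b, a) \in upairs s) = false.
  move=> /eqP->; apply: contraNF zs => /orP[] /mem_upairs /=; by case/andP.
rewrite !inE !mem_cat !mapE /swap /=.
case: (x =P z) => [xz|_]; case: (y =P z) => [yz|_] //=.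
- by rewrite xz yz eqxx in nxy.
- move=> _ ys; rewrite ys /=.
  by have /norP[_ /negbTE] := negbT (nz x y (introT eqP xz)).
- move=> xs _; rewrite xs /=.
  by have /norP[_ /negbTE->] := negbT (nz y x (introT eqP yz)).
by move=> xs ys; rewrite IHs.
Qed.

End UnorderedPairs.

(** * Consecutive pairs of a path, and undirected links *)

Section Steps.
Variable T : eqType.
Implicit Types (w a b : seq T) (p : T * T) (M : seq (T * T)).

Definition steps w := zip w (behead w).

Definition linked M x y := ((x, y) \in M) || ((y, x) \in M).

Lemma linkedC M x y : linked M x y = linked M y x.
Proof. exact: orbC. Qed.

Lemma linked_cat M1 M2 x y :
  linked (M1 ++ M2) x y = linked M1 x y || linked M2 x y.
Proof. by rewrite /linked !mem_cat orbACA. Qed.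

Lemma steps_cat a u x b :
  steps (rcons a u ++ x :: b) = steps (rcons a u) ++ (u, x) :: steps (x :: b).
Proof.
by rewrite /steps; elim: a => //= y [|z a] //= ->.
Qed.

Lemma mem_steps w p : p \in steps w -> (p.1 \in w) && (p.2 \in w).
Proof.
case: w => // x w; rewrite /steps /=; elim: w x => //= y w IHw x.
rewrite !inE => /predU1P[-> /=|/IHw /andP[]]; first by rewrite !eqxx !orbT.
by rewrite !inE => -> ->; rewrite !orbT.
Qed.

Lemma linked_steps w x y : linked (steps w) x y -> (x \in w) && (y \in w).
Proof. by case/orP=> /mem_steps /= /andP[-> ->]. Qed.

Lemma steps_uniq w : uniq w -> uniq (steps w).
Proof.
case: w => // x w; rewrite /steps /=; elim: w x => //= y w IHw x.
move=> /andP[xw uyw]; rewrite IHw // andbT; apply: contra xw.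
by move=> /(@mem_steps (y :: w)) /= /andP[].
Qed.

Lemma steps_irr w x y : uniq w -> (x, y) \in steps w -> x != y.
Proof.
case: w => // z w; rewrite /steps /=; elim: w z => //= a w IHw z.
move=> /andP[zw uw]; rewrite inE => /predU1P[[-> ->]|/(IHw _ uw)//].
by apply: contraNneq zw => ->; rewrite mem_head.
Qed.

(** A self-avoiding path runs along an edge in one direction only; this later makes the forgetting
    of orientations injective on steps. *)
Lemma steps_swap w p : uniq w -> p \in steps w -> swap p \notin steps w.
Proof.
case: w => // z w; rewrite /steps /=; elim: w z p => //= a w IHw z p.
move=> /andP[zw uw]; rewrite !inE => /predU1P[->|pw].
  rewrite negb_or xpair_eqE /=; apply/andP; split.
    by apply: contra zw => /andP[/eqP<- _]; rewrite mem_head.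
  by apply: contra zw => /(@mem_steps (a :: w)) /andP[].
rewrite negb_or IHw // andbT; apply: contra zw => /eqP ep.
by move: (@mem_steps (a :: w) _ pw) => /andP[_]; case: p ep {pw} => ? ? [-> _].
Qed.

End Steps.

Definition map_pair (T T' : Type) (f : T -> T') (p : T * T) := (f p.1, f p.2).

Lemma map_steps (T T' : eqType) (f : T -> T') w :
  steps (map f w) = map (map_pair f) (steps w).
Proof.
by case: w => // x w; rewrite /steps /=; elim: w x => //= y w IHw x; rewrite IHw.
Qed.

Lemma permutations_map (T T' : eqType) (f : T -> T') (V : seq T) :
  injective f ->
  perm_eq (permutations (map f V)) (map (map f) (permutations V)).
Proof.
move=> injf; apply: uniq_perm; rewrite ?permutations_uniq //.
  by rewrite map_inj_uniq ?permutations_uniq //; apply: inj_map.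
move=> t; rewrite mem_permutations; apply/idP/mapP => [tfV|[t' + ->]]; last first.
  by rewrite mem_permutations; apply: perm_map.
case: V tfV => [|x0 V] tfV.
  by exists [::]; last by case: t tfV => // ? ? /perm_size.
(* A list of positions in [V] describes the permutation, which provides a preimage under [map f]
   without an inverse of [f]. *)
have [I _ tE] := @perm_iotaP _ _ _ (f x0) tfV.
have {}tE : t = map f (map (nth x0 (x0 :: V)) I).
  rewrite tE -map_comp; apply: eq_map => i.
  by elim: (x0 :: V) i {I tfV tE} => [|x s IHs] [|i] //=.
rewrite {}tE in tfV *; exists (map (nth x0 (x0 :: V)) I) => //.
by rewrite mem_permutations (perm_map_inj injf tfV).
Qed.

Ltac bool_cases :=
  repeat match goal with
  | |- context [?x == ?y] => case: (x == y) => //=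
  | |- context [?x \in ?y] => case: (x \in y) => //=
  end.

(** * Vertex elimination in a graph with symmetric adjacency *)

Section Elimination.
Variables (T : eqType) (S E : T) (e : rel T).
Hypothesis e_sym : symmetric e.
Implicit Types (V t w : seq T) (p : T * T) (M : seq (T * T)).

(** A mandatory link may be walked along even if its ends are not adjacent: it stands for a stretch
    through deleted vertices. *)
Definition nb M x y := e x y || linked M x y.

Definition admissible M w :=
  all (fun p => nb M p.1 p.2) (steps w)
  && all (fun p => linked (steps w) p.1 p.2) M.

Definition hamcount V M :=
  count (fun t => admissible M (S :: rcons t E)) (permutations V).

Definition avoid v M := [seq p <- M | (p.1 != v) && (p.2 != v)].

(** The condition for [v] to be passed between the two ends of [p]. By the last clause the two steps
    at [v] realise every link at [v], which is why [avoid] may then discard these links. *)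
Definition joinable v M p :=
  [&& nb M v p.1, nb M v p.2, ~~ linked M p.1 p.2
    & all (fun q => (q.1 != v) && (q.2 != v)
         || linked [:: (v, p.1); (v, p.2)] q.1 q.2) M].

(* If v already has more than one link, joinable leaves at most one pair, and if
   it has more than two, none. *)
Definition elim_vertex v V M :=
  [seq p :: avoid v M | p <- upairs [seq x <- [:: S, E & V] | nb M v x]
                      & joinable v M p].

Lemma nbC M x y : nb M x y = nb M y x.
Proof. by rewrite /nb e_sym linkedC. Qed.

Lemma joinableC v M p : joinable v M (swap p) = joinable v M p.
Proof.
rewrite /joinable /= (linkedC M) andbCA; congr [&& _, _, _ & _].
by apply: eq_all => q; rewrite /linked !inE; bool_cases.
Qed.

Lemma linked_avoid v M x y :
  linked (avoid v M) x y = [&& x != v, y != v & linked M x y].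
Proof.
rewrite /linked /avoid !mem_filter /=.
by bool_cases.
Qed.

Lemma admissibleP M w :
  reflect ({in steps w, forall p, nb M p.1 p.2}
           /\ {in M, forall p, linked (steps w) p.1 p.2}) (admissible M w).
Proof. by apply: (iffP andP) => -[/allP ? /allP ?]. Qed.

Lemma eq_nb_linked M1 M2 x y : linked M1 x y = linked M2 x y -> nb M1 x y = nb M2 x y.
Proof. by rewrite /nb => ->. Qed.

Lemma linked_mem M p : p \in M -> linked M p.1 p.2.
Proof. by case: p => x y Mp; rewrite /linked Mp. Qed.

Lemma eq_admissible M1 M2 w : linked M1 =2 linked M2 ->
  admissible M1 w = admissible M2 w.
Proof.
move=> eqM; apply/admissibleP/admissibleP => -[stepsM Msteps]; split=> p.
- by rewrite (eq_nb_linked (esym (eqM _ _))); apply: stepsM.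
- by case: p => x y /linked_mem; rewrite -eqM => /orP[] /Msteps //; rewrite linkedC.
- by rewrite (eq_nb_linked (eqM _ _)); apply: stepsM.
by case: p => x y /linked_mem; rewrite eqM => /orP[] /Msteps //; rewrite linkedC.
Qed.

(* The condition that u and x are not already linked excludes closing a cycle:
   a mandatory link between u and x cannot be realised when v separates them. *)
Lemma admissible_insert M a u v x b : uniq (rcons a u ++ v :: x :: b) ->
  admissible M (rcons a u ++ v :: x :: b)
  = joinable v M (u, x) && admissible ((u, x) :: avoid v M) (rcons a u ++ x :: b).
Proof.
rewrite cat_uniq => /and3P[_ /hasPn aF /= /andP[vF /andP[xb _]]].
have va : v \notin rcons a u by apply: aF; rewrite mem_head.
have xa : x \notin rcons a u by apply: aF; rewrite !inE eqxx orbT.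
have ub : u \notin x :: b.
  by apply/negP => ub; have := aF u; rewrite inE ub orbT mem_rcons mem_head => /(_ isT).
(* [XY] collects the steps common to both paths. Besides them one path has the steps through [v],
   the other only the step from [u] to [x]. *)
pose XY := steps (rcons a u) ++ steps (x :: b).
have sW p : p \in steps (rcons a u ++ v :: x :: b) =
    (p \in XY) || (p \in [:: (u, v); (v, x)]).
  rewrite (steps_cat a u v (x :: b)) -[steps (v :: _)]/((v, x) :: _).
  by rewrite /XY !(mem_cat, inE); bool_cases.
have sW' p : p \in steps (rcons a u ++ x :: b) = (p \in XY) || (p \in [:: (u, x)]).
  by rewrite steps_cat /XY !(mem_cat, inE); bool_cases.
have linkW y z : linked (steps (rcons a u ++ v :: x :: b)) y z
    = linked XY y z || linked [:: (u, v); (v, x)] y z.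
  by rewrite -linked_cat /linked !sW !mem_cat.
have linkW' y z : linked (steps (rcons a u ++ x :: b)) y z
    = linked XY y z || linked [:: (u, x)] y z.
  by rewrite -linked_cat /linked !sW' !mem_cat.
have l2 y z : linked [:: (v, u); (v, x)] y z = linked [:: (u, v); (v, x)] y z.
  by rewrite /linked !inE !xpair_eqE; bool_cases.
have XYv y z : linked XY y z -> (y != v) && (z != v).
  rewrite /XY linked_cat => /orP[] /linked_steps /andP[ys zs].
    by apply/andP; split; apply: contraNneq va => <-.
  by apply/andP; split; apply: contraNneq vF => <-.
have XYux : linked XY u x = false.
  rewrite /XY linked_cat; apply/norP; split; apply/negP => /linked_steps /andP[].
    by rewrite (negbTE xa).
  by rewrite (negbTE ub).
have nuv : (u == v) = false by apply: contraNF va => /eqP<-; rewrite mem_rcons mem_head.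
have nxv : (x == v) = false by apply: contraNF vF => /eqP<-; rewrite mem_head.
have nux : (u == x) = false by apply: contraNF ub => /eqP->; rewrite mem_head.
(* The two sets of links differ only at [v] and at the pair of [u] and [x]; no common step touches
   [v] or joins [u] and [x]. *)
have nbXY p : p \in XY -> nb ((u, x) :: avoid v M) p.1 p.2 = nb M p.1 p.2.
  move=> /linked_mem pXY; have /andP[p1 p2] := XYv _ _ pXY.
  apply: eq_nb_linked; rewrite -cat1s linked_cat linked_avoid p1 p2 /=.
  case: (boolP (linked [:: _] _ _)) => // /orP[]; rewrite inE => /eqP[p1E p2E];
    by move: pXY; rewrite p1E p2E ?(linkedC _ x) XYux.
apply/admissibleP/andP => [[stepsM Msteps] |
    [/and4P[vu vx Mux /allP allM] /admissibleP[stepsM' Msteps']]].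
  split.
    apply/and4P; split.
    - by rewrite nbC; apply: (stepsM (u, v)); rewrite sW !inE eqxx orbT.
    - by apply: (stepsM (v, x)); rewrite sW !inE eqxx !orbT.
    - apply/negP => /orP[] /Msteps /=; rewrite ?(linkedC _ x) linkW XYux /=.
        by rewrite /linked !inE !xpair_eqE nuv nux nxv !andbF.
      by rewrite /linked !inE !xpair_eqE nuv nux nxv !andbF.
    - by apply/allP => q /Msteps; rewrite linkW l2 => /orP[/XYv->|->] //; rewrite orbT.
  apply/admissibleP; split=> p.
    rewrite sW' => /orP[pXY|]; last first.
      by rewrite inE => /eqP->; rewrite /nb /linked mem_head orbT.
    by rewrite nbXY //; apply: stepsM; rewrite sW pXY.
  rewrite inE => /predU1P[->|]; first by rewrite linkW' /linked mem_head orbT.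
  rewrite mem_filter => /andP[/andP[p1 p2] /Msteps].
  rewrite linkW linkW' => /orP[->//|].
  by rewrite /linked !inE !xpair_eqE (negbTE p1) (negbTE p2) !andbF.
split=> p.
  rewrite sW => /orP[pXY|]; first by rewrite -nbXY //; apply: stepsM'; rewrite sW' pXY.
  by rewrite !inE => /orP[] /eqP-> //=; rewrite nbC.
move=> Mp; rewrite linkW; have /orP[pv|] := allM _ Mp; last first.
  by rewrite l2 => ->; rewrite orbT.
have /Msteps' : p \in (u, x) :: avoid v M by rewrite inE mem_filter pv Mp orbT.
rewrite linkW' => /orP[->//|]; rewrite /linked !inE => /orP[] /eqP[p1E p2E].
  by case/negP: Mux; have := linked_mem Mp; rewrite p1E p2E.
by case/negP: Mux; have := linked_mem Mp; rewrite p1E p2E linkedC.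
Qed.

Definition insert v t i := take i t ++ v :: drop i t.

(** The slot is recovered by [index] and the shorter permutation by filtering out [v], so every
    permutation arises exactly once. *)
Lemma permutations_insert v V : v \notin V ->
  perm_eq (permutations (v :: V))
    [seq insert v t i | t <- permutations V, i <- iota 0 (size V).+1].
Proof.
move=> vV; have ins t i : t \in permutations V -> i \in iota 0 (size V).+1 ->
    index v (insert v t i) = i /\ [seq x <- insert v t i | x != v] = t.
  rewrite mem_permutations mem_iota ltnS => tV /=; rewrite -(perm_size tV) => it.
  have vt : v \notin t by rewrite (perm_mem tV).
  have vtake : v \notin take i t by apply: contra vt; apply: mem_take.
  rewrite /insert index_cat (negbTE vtake) /= eqxx addn0 size_take_min (minn_idPl it).
  split=> //; rewrite filter_cat /= eqxx /= -filter_cat cat_take_drop.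
  by apply/all_filterP/allP => x; apply: contraTneq => ->.
apply: uniq_perm; first exact: permutations_uniq.
  apply: allpairs_uniq; rewrite ?permutations_uniq ?iota_uniq //.
  move=> p p' pI p'I; case/allpairsP: pI => -[t i] /= [tV iV ->].
  case/allpairsP: p'I => -[t' i'] /= [tV' iV' ->] /= eqi.
  have [iE tE] := ins _ _ tV iV; have [iE' tE'] := ins _ _ tV' iV'.
  by congr (_, _); [rewrite -tE eqi | rewrite -iE eqi].
move=> t; rewrite mem_permutations; apply/idP/allpairsP => [tV|[[t' i] /= [tV iV ->]]].
  have vt : v \in t by rewrite (perm_mem tV) mem_head.
  case/splitPr: vt tV => a b tV; exists (a ++ b, size a); split.
  - rewrite -[_.1]/(a ++ b) mem_permutations -(perm_cons v).
    by rewrite -[v :: a ++ b]/([:: v] ++ a ++ b) perm_catCA.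
  - rewrite mem_iota -[_.2]/(size a) /= add0n ltnS -ltnS.
    rewrite -[(size V).+1]/(size (v :: V)) -(perm_size tV).
    by rewrite size_cat /= addnS ltnS leq_addr.
  - by rewrite /insert /= take_size_cat // drop_size_cat.
rewrite mem_permutations in tV; rewrite /insert -[v :: drop _ _]cat1s perm_catCA.
by rewrite cat_take_drop /= perm_cons.
Qed.

(** The steps of the path correspond to the slots of [insert]; the defaults [S] and [E] supply the
    neighbours at the two extreme slots. *)
Lemma steps_rcons t : steps (S :: rcons t E) =
  [seq (last S (take i t), head E (drop i t)) | i <- iota 0 (size t).+1].
Proof.
rewrite /steps -[behead _]/(rcons t E); elim: t S => // y t IHt z.
rewrite -[iota 0 _]/(0 :: iota (1 + 0) (size t).+1) iotaDl map_cons -map_comp.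
by rewrite rcons_cons -[zip _ _]/((z, y) :: zip (y :: rcons t E) (rcons t E)) IHt.
Qed.

Lemma hamcountE V M :
  hamcount V M = \sum_(t <- permutations V) admissible M (S :: rcons t E).
Proof. by rewrite /hamcount -sum1_count big_mkcond. Qed.

(** Double counting for a fixed order [t] of [V]: the slots that can receive [v] are the steps of
    [W] satisfying [G], and they match the unordered pairs satisfying [G], because the new mandatory
    link forces such a pair to be a step. *)
Lemma hamcount_elim v V M : uniq [:: S, E, v & V] ->
  hamcount (v :: V) M = \sum_(M' <- elim_vertex v V M) hamcount V M'.
Proof.
move=> uV; have [uSEV vV] : uniq [:: S, E & V] /\ v \notin V.
  move: uV; rewrite /= !inE !negb_or -!andbA => /and5P[-> _ -> _].
  by case/and3P=> -> -> ->.
rewrite hamcountE (perm_big _ (permutations_insert vV)) big_allpairs_dep /=.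
under [RHS]eq_bigr do rewrite hamcountE.
rewrite [RHS]exchange_big /=; apply: eq_big_seq => t; rewrite mem_permutations => tV.
set W := S :: rcons t E.
have permW : perm_eq W [:: S, E & V] by rewrite perm_cons perm_rcons perm_cons.
have uW : uniq W by rewrite (perm_uniq permW).
rewrite -(perm_size tV) big_map big_filter_cond.
pose G p := joinable v M p && admissible (p :: avoid v M) W.
have GC p : G (swap p) = G p.
  rewrite /G joinableC; congr (_ && _); apply: eq_admissible => x y.
  by rewrite /linked !inE /swap; case: p => p1 p2; rewrite !xpair_eqE; bool_cases.
transitivity (count G (steps W)).
  rewrite steps_rcons count_map -sum1_count [RHS]big_mkcond /=.
  apply: eq_bigr => i _.
  have -> : S :: rcons (insert v t i) E
    = rcons (belast S (take i t)) (last S (take i t))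
      ++ v :: head E (drop i t) :: behead (rcons (drop i t) E).
    by rewrite -lastI /insert rcons_cat /=; case: (drop i t).
  rewrite admissible_insert.
    rewrite -lastI -[head E _ :: _]/(head E _ :: _).
    have -> : (S :: take i t) ++ head E (drop i t) :: behead (rcons (drop i t) E) = W.
      by rewrite /W -[in RHS](cat_take_drop i t) rcons_cat; case: (drop i t).
    by rewrite -/(G _); case: (G _).
  rewrite -lastI; move: uV; congr (is_true _); apply: perm_uniq.
  have -> : head E (drop i t) :: behead (rcons (drop i t) E) = rcons (drop i t) E.
    by case: (drop i t).
  apply/permP => f; have /permP/(_ f) := tV; rewrite -{1}(cat_take_drop i t).
  by rewrite /= !count_cat /= -cats1 count_cat /=; lia.
set N := [seq x <- _ | _]; have uN : uniq N by apply: filter_uniq.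
transitivity (count G (upairs N)); last first.
  rewrite -sum1_count big_mkcond [RHS]big_mkcond; apply: eq_bigr => p _.
  by rewrite /G; case: joinable; case: admissible.
rewrite -!size_filter.
(* [norm] turns a step to the orientation listed by [upairs]; it matches the steps satisfying [G]
   with the pairs satisfying [G]. *)
pose norm p := if p \in upairs N then p else swap p.
have normP p : p \in steps W -> G p -> norm p \in upairs N.
  move=> pW /andP[/and4P[p1 p2 _ _] _]; have /andP[W1 W2] := mem_steps pW.
  rewrite /norm; case: ifPn => // nP; rewrite upairs_swap //.
  - by case: p pW {p1 p2 W1 W2 nP} => x y /(steps_irr uW).
  - by rewrite mem_filter p1 -(perm_mem permW).
  - by rewrite mem_filter p2 -(perm_mem permW).
have normG p : G (norm p) = G p by rewrite /norm; case: ifP; rewrite ?GC.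
rewrite -(size_map norm); apply: perm_size; apply: uniq_perm.
- rewrite map_inj_in_uniq ?filter_uniq ?steps_uniq // => p q.
  rewrite !mem_filter => /andP[_ pW] /andP[_ qW]; rewrite /norm.
  have swapK : involutive (@swap T) by case.
  case: ifP; case: ifP => // _ _; last exact: (can_inj swapK).
    by move=> pE; case/negP: (steps_swap uW qW); rewrite -pE.
  by move=> qE; case/negP: (steps_swap uW pW); rewrite qE.
- by apply/filter_uniq/upairs_uniq.
move=> p; rewrite mem_filter; apply/mapP/andP => [[q] | [Gp pP]].
  by rewrite mem_filter => /andP[Gq qW] ->; rewrite normG normP.
(* The pair itself is a mandatory link in [G], hence a step in one of its two orientations. *)
have /andP[_ /admissibleP[_ /(_ p (mem_head _ _))]] := Gp.
case: p Gp pP => x y Gp pP /= /orP[] pW.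
  by exists (x, y); rewrite ?mem_filter ?Gp // /norm pP.
exists (y, x); first by rewrite mem_filter pW andbT -GC.
have yx := steps_irr uW pW.
rewrite /norm ifN //; move: (mem_upairs pP) => /= /andP[xN yN].
by rewrite -[(y, x)]/(swap (x, y)) upairs_swap // 1?eq_sym // negbK.
Qed.

Fixpoint elim_vertices vs W M :=
  if vs is v :: vs' then
    flatten [seq elim_vertices vs' W M' | M' <- elim_vertex v (vs' ++ W) M]
  else [:: M].

(** Far vertices [R] are neither adjacent nor linked to what is deleted, so the list of resulting
    link sets does not depend on [R]. This gives one transfer rule for every number of columns. *)
Lemma hamcount_elim_vertices vs W R M : uniq [:: S, E & vs ++ W ++ R] ->
    {in vs & R, forall v x, ~~ e v x} ->
    {in M, forall p, (p.1 \notin R) && (p.2 \notin R)} ->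
  hamcount (vs ++ W ++ R) M = \sum_(M' <- elim_vertices vs W M) hamcount (W ++ R) M'.
Proof.
elim: vs M => [|v vs IHvs] M uV eR MR; first by rewrite big_seq1.
have uV' : uniq [:: S, E & vs ++ W ++ R].
  move: uV; rewrite /= !inE !negb_or -!andbA => /and5P[-> _ -> _].
  by case/and3P=> -> _ ->.
rewrite cat_cons hamcount_elim // big_flatten big_map /=.
have -> : elim_vertex v (vs ++ W ++ R) M = elim_vertex v (vs ++ W) M.
  rewrite /elim_vertex catA -[[:: S, E & _]]/([:: S, E & vs ++ W] ++ R) filter_cat.
  rewrite [X in _ ++ X](_ : _ = [::]) ?cats0 //.
  apply/eqP; rewrite -[_ == _]negbK -has_filter; apply/hasPn => x xR.
  rewrite /nb negb_or eR ?mem_head //=; apply/negP.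
  by case/orP=> /MR; rewrite xR ?andbF.
apply: eq_big_seq => M' /mapP[p]; rewrite mem_filter => /andP[_ /mem_upairs].
rewrite !mem_filter => /andP[/andP[_ p1] /andP[_ p2]] ->.
(* The ends of the new link lie among the ghosts, [vs] and [W], so links keep avoiding [R]. *)
have notR x : x \in [:: S, E & vs ++ W] -> x \notin R.
  move: uV'; rewrite catA -[[:: S, E & _]]/([:: S, E & vs ++ W] ++ R) cat_uniq.
  by move=> /and3P[_ /hasPn sR _] xVW; apply/negP => /sR; rewrite xVW.
apply: IHvs => // [u x uvs xR|q]; first by apply: eR xR; rewrite inE uvs orbT.
by rewrite inE mem_filter => /predU1P[->|/andP[_ /MR//]]; rewrite !notR.
Qed.

Definition same_links M1 M2 :=
  all (fun p => linked M2 p.1 p.2) M1 && all (fun p => linked M1 p.1 p.2) M2.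

Lemma same_linksP M1 M2 : same_links M1 M2 -> linked M1 =2 linked M2.
Proof.
case/andP=> /allP M12 /allP M21 x y; apply/idP/idP.
  by case/orP=> /M12 //; rewrite linkedC.
by case/orP=> /M21 //; rewrite linkedC.
Qed.

Lemma eq_hamcount V M1 M2 : linked M1 =2 linked M2 -> hamcount V M1 = hamcount V M2.
Proof. by move=> eqM; apply: eq_count => t; apply: eq_admissible. Qed.

Lemma hamcount_map f V M : injective f -> f S = S -> f E = E ->
    {mono f : x y / e x y} ->
  hamcount (map f V) (map (map_pair f) M) = hamcount V M.
Proof.
move=> injf fS fE ef.
have linkf M' x y : linked (map (map_pair f) M') (f x) (f y) = linked M' x y.
  have inj2 : injective (map_pair f) by move=> [? ?] [? ?] [/injf-> /injf->].
  by rewrite /linked -(mem_map inj2 M' (x, y)) -(mem_map inj2 M' (y, x)).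
rewrite /hamcount (permP (permutations_map _ injf)) count_map; apply: eq_count => t /=.
rewrite -{1}fS -{1}fE -map_rcons -map_cons /admissible map_steps !all_map.
congr (_ && _).
  by apply: eq_all => p /=; rewrite /nb ef linkf.
by apply: eq_all => p /=; rewrite linkf.
Qed.

End Elimination.

(** * The grid with four rows *)

(* The two ghost sites are inr false, the start, and inr true, the stop. *)
Definition site : eqType := ((nat * nat) + bool)%type.
Definition cell (r c : nat) : site := inl (r, c).
Definition start : site := inr false.
Definition stop : site := inr true.

Definition dist m n := (m - n) + (n - m).

(** [stop] is adjacent to every cell and [start] to none: the mandatory link in [init] is the only
    way out of [start]. *)
Definition adj (x y : site) : bool :=
  match x, y with
  | inl u, inl v => dist u.1 v.1 + dist u.2 v.2 == 1
  | inl _, inr g | inr g, inl _ => g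
  | inr _, inr _ => false
  end.

Lemma adj_sym : symmetric adj.
Proof.
move=> [u|g] [v|h] //=.
by rewrite /dist [X in X + _ == _]addnC [X in _ + X == _]addnC.
Qed.

Definition column c : seq site := [seq cell r c | r <- iota 0 4].
Definition columns m n : seq site := flatten [seq column c | c <- iota m n].

Definition count_tours n M := hamcount start stop adj (columns 0 n) M.

Definition init : seq (site * site) := [:: (start, cell 0 0)].

Lemma mem_column r c d : (cell r c \in column d) = (r < 4) && (c == d).
Proof.
apply/mapP/andP => [[r']|[r4 /eqP->]]; last by exists r; rewrite ?mem_iota.
by rewrite mem_iota /= add0n => r4 [-> ->].
Qed.

Lemma mem_columns m n r c :
  (cell r c \in columns m n) = (r < 4) && (m <= c < m + n).
Proof.
rewrite -mem_iota; apply/flatten_mapP/andP => [[d dmn]|[r4 cmn]].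
  by rewrite mem_column => /andP[-> /eqP->].
by exists c; rewrite // mem_column r4 eqxx.
Qed.

Lemma notin_columns m n g : (inr g : site) \notin columns m n.
Proof. by apply/negP => /flatten_mapP[c _ /mapP[]]. Qed.

Lemma columns_uniq m n : uniq (columns m n).
Proof.
apply: allpairs_uniq; rewrite ?iota_uniq // => p q _ _ /=.
by case: p q => [? ?] [? ?] [-> ->].
Qed.

(** * Greek key tours as Hamiltonian paths between the ghost sites *)

Section Tours.
Variable n : nat.
Implicit Types u v : vertex 4 n.

Definition site_of u := cell u.1 u.2.

Lemma site_of_inj : injective site_of.
Proof. by move=> [r c] [r' c'] [/val_inj-> /val_inj->]. Qed.

Lemma columns_enum : perm_eq (columns 0 n) (map site_of (enum {: vertex 4 n})).
Proof.
apply: uniq_perm; rewrite ?columns_uniq ?(map_inj_uniq site_of_inj) ?enum_uniq //.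
case=> [[r c]|g]; last first.
  by rewrite (negbTE (notin_columns _ _ _)); apply/esym/mapP => -[].
rewrite mem_columns /= add0n; apply/andP/mapP => [[r4 cn]|[[r' c'] _ [-> ->]]].
  by exists (Ordinal r4, Ordinal cn); rewrite ?mem_enum.
by rewrite !ltn_ord.
Qed.

Lemma adj_site_of u v : adj (site_of u) (site_of v) = grid_adj u v.
Proof.
rewrite /adj /grid_adj /=.
have distE (a b : nat) : `|a - b|%N = dist a b by rewrite /dist; lia.
rewrite !distE; case: dist => [|[|a]]; case: dist => [|[|b]] //.
Qed.

(** The link in [init] forces the first cell to be the corner, and the final step into [stop] is
    always permitted. *)
Lemma admissible_tour u p :
  admissible adj init (start :: rcons (map site_of (u :: p)) stop)
  = upper_left u && path (@grid_adj 4 n) u p.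
Proof.
have stepsE : all (fun q => nb adj init q.1 q.2)
    (steps (site_of u :: rcons (map site_of p) stop)) = path (@grid_adj 4 n) u p.
  elim: p u => [|v p IHp] u //=; rewrite -IHp; congr (_ && _).
  by rewrite /nb adj_site_of /linked !inE !xpair_eqE /= orbF.
rewrite -[upper_left u]/(site_of u == cell 0 0).
have nb_start : nb adj init start (site_of u) = (site_of u == cell 0 0).
  by rewrite /nb /linked !inE !xpair_eqE /= orbF eq_sym.
set w := rcons (map site_of p) stop in stepsE *.
transitivity ((nb adj init start (site_of u)
               && all (fun q => nb adj init q.1 q.2) (steps (site_of u :: w)))
    && (linked ((start, site_of u) :: steps (site_of u :: w)) start (cell 0 0)
        && true)).
  by [].
rewrite stepsE nb_start andbT; case: eqP => [->|_] //=.
by rewrite /linked mem_head andbT.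
Qed.

Lemma tours_enum :
  perm_eq (map val (enum [set t : (4 * n).-tuple (vertex 4 n) | greek_key_tour t]))
    [seq t <- permutations (enum {: vertex 4 n}) | greek_key_tour t].
Proof.
apply: uniq_perm; rewrite ?filter_uniq ?permutations_uniq //.
  by rewrite map_inj_uniq ?enum_uniq //; apply: val_inj.
move=> s; rewrite mem_filter mem_permutations; apply/mapP/andP => [[t]|[tour perm_s]].
  rewrite mem_enum inE => tour ->; split=> //.
  rewrite /=; case: (tval t) tour => //= u p /and4P[_ _ us /forallP allp].
  by apply: uniq_perm; rewrite ?enum_uniq // => v; rewrite allp mem_enum.
have size_s : size s == 4 * n.
  by rewrite (perm_size perm_s) -cardE card_prod !card_ord.
by exists (Tuple size_s); rewrite // mem_enum inE.
Qed.

(** Without columns the link to the corner cannot be realised and the count is 0, whereas the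
    convention sets [greek_key 4 0] to 1. *)
Lemma greek_keyE : 0 < n -> greek_key 4 n = count_tours n init.
Proof.
rewrite /greek_key /count_tours /hamcount; case: eqP => [->|_ _] //.
rewrite (permP (perm_permutations columns_enum)).
rewrite (permP (permutations_map _ site_of_inj)).
rewrite count_map cardE -(size_map val) (perm_size tours_enum) size_filter.
apply: eq_in_count => t; rewrite mem_permutations => perm_t.
case: t perm_t => [//|u p] perm_t.
transitivity (upper_left u && path (@grid_adj 4 n) u p); last first.
  by rewrite -admissible_tour.
rewrite /greek_key_tour.
have -> : uniq (u :: p) by rewrite (perm_uniq perm_t) enum_uniq.
have -> : [forall v, v \in u :: p].
  by apply/forallP => v; rewrite (perm_mem perm_t) mem_enum.
by rewrite !andbT.
Qed.

End Tours.

(** * Translation by one column and the transfer step *)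

Definition shift (x : site) : site :=
  if x is inl (r, c) then cell r c.+1 else x.

Definition unshift (x : site) : site :=
  if x is inl (r, c) then cell r c.-1 else x.

Lemma shift_inj : injective shift.
Proof. by move=> [[r c]|g] [[r' c']|g'] //= [-> ->]. Qed.

Lemma adj_shift : {mono shift : x y / adj x y}.
Proof. by move=> [[r c]|g] [[r' c']|g'] //=; rewrite /dist !subSS. Qed.

Lemma columns_shift m n : map shift (columns m n) = columns m.+1 n.
Proof.
rewrite /columns map_flatten -map_comp -add1n iotaDl -map_comp.
by congr flatten; apply: eq_map.
Qed.

Definition transfer M :=
  elim_vertices start stop adj (column 0) (column 1) M.

Definition low (x : site) := if x is inl (r, c) then c <= 1 else true.

Lemma count_tours_transfer n M : all (fun p => low p.1 && low p.2) M ->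
  count_tours n.+2 M =
    \sum_(M' <- transfer M) hamcount start stop adj (columns 1 n.+1) M'.
Proof.
move=> /allP lowM; rewrite /count_tours.
have uV : uniq [:: start, stop & columns 0 n.+2].
  have := columns_uniq 0 n.+2.
  have := notin_columns 0 n.+2 true; have := notin_columns 0 n.+2 false.
  by move: (columns 0 n.+2) => V startV stopV /=; rewrite inE negb_or startV stopV.
have -> : columns 0 n.+2 = column 0 ++ column 1 ++ columns 2 n by [].
have lowR x : low x -> x \notin columns 2 n.
  case: x => [[r c]|g] /=; last by rewrite notin_columns.
  by rewrite mem_columns; lia.
apply: hamcount_elim_vertices => //; first exact: adj_sym.
- move=> v x; case: v => [[r c]|g]; last by rewrite (negbTE (notin_columns 0 1 _)).
  rewrite mem_column => /andP[_ /eqP<-]; case: x => [[r' c']|g'].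
    rewrite mem_columns /adj /dist /= => /and3P[_ c2 _]; apply/negP => /eqP; lia.
  by rewrite (negbTE (notin_columns _ _ _)).
by move=> p /lowM/andP[/lowR-> /lowR->].
Qed.

Lemma count_tours_shift n M :
  hamcount start stop adj (columns 1 n) (map (map_pair shift) M) = count_tours n M.
Proof. by rewrite -columns_shift hamcount_map //; [exact: shift_inj | exact: adj_shift]. Qed.

(** * The transfer matrix *)

(** Moves the links back to the first column and lists them in a fixed order, so that equal link
    sets become equal lists for [undup] and [index]. *)
Definition normal M := [seq p <- upairs [:: start, stop & column 0] |
  linked (map (map_pair unshift) M) p.1 p.2].

(* Three rounds reach a set closed under transfer; that it is closed is part of
   transitions_ok. *)
Definition states := Eval vm_compute in
  iter 3 (fun s => undup (s ++ flatten [seq map normal (transfer M) | M <- s]))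
    [:: init].

Definition transitions := Eval vm_compute in
  [seq [seq index (normal M') states | M' <- transfer M] | M <- states].

(** Certifies the computed tables directly against [transfer]. Since [index] returns the length of
    the list on failure, the bound on [j] expresses closure of [states]. *)
Definition transition_ok i :=
  all (fun p => low p.1 && low p.2) (nth [::] states i) &&
  all2 (fun M j => (j < size states)
          && same_links M (map (map_pair shift) (nth [::] states j)))
       (transfer (nth [::] states i)) (nth [::] transitions i).

Lemma transitions_ok : all transition_ok (iota 0 (size states)).
Proof. by vm_compute. Qed.

Definition state_count n i := count_tours n.+1 (nth [::] states i).

Lemma eq_sum_all2 (S T : Type) (F : S -> nat) (G : T -> nat)
    (P : S -> T -> bool) s t :
    (forall x y, P x y -> F x = G y) -> all2 P s t ->
  \sum_(x <- s) F x = \sum_(y <- t) G y.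
Proof.
move=> FG; elim: s t => [|x s IHs] [|y t] //=; first by rewrite !big_nil.
by case/andP=> /FG FGxy /IHs FGst; rewrite !big_cons FGxy FGst.
Qed.

Lemma state_countS n i : i < size states ->
  state_count n.+1 i = \sum_(j <- nth [::] transitions i) state_count n j.
Proof.
move=> lt_i; have /allP/(_ i) := transitions_ok.
rewrite mem_iota lt_i => /(_ isT)/andP[lowM okM].
rewrite /state_count count_tours_transfer //.
apply: eq_sum_all2 okM => M j /andP[_ /same_linksP/eq_hamcount->].
exact: count_tours_shift.
Qed.

Lemma transitions_lt i j : i < size states ->
  j \in nth [::] transitions i -> j < size states.
Proof.
move=> lt_i; have /allP/(_ i) := transitions_ok.
rewrite mem_iota lt_i => /(_ isT)/andP[_].
elim: (nth _ transitions i) (transfer _) => // k s IHs [|M Ms] //=.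
by case/andP=> /andP[lt_k _] /IHs lt_s; rewrite inE => /predU1P[->|/lt_s].
Qed.

(** * The linear recurrence of order eight *)

Local Open Scope ring_scope.

(** Binary integers keep the iterates cheap for [vm_compute]; [int_of_Z] carries the results over to
    [int]. *)
Definition counts0 : seq BinInt.Z := Eval vm_compute in
  [seq BinInt.Z.of_nat (count_tours 1 M) | M <- states].

Definition next (h : seq BinInt.Z) : seq BinInt.Z :=
  [seq foldr (fun j s => h`_j + s) 0 js | js <- transitions].

Definition counts n := iter n next counts0.

Lemma countsE n i : (i < size states)%N ->
  (state_count n i)%:Z = int_of_Z (counts n)`_i.
Proof.
elim: n i => [|n IHn] i lt_i; last first.
  rewrite state_countS // /counts iterS -/(counts n) (nth_map [::]) //.
  have: {in nth [::] transitions i, forall j, (j < size states)%N}.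
    by move=> j; apply: transitions_lt.
  elim: (nth _ transitions i) => [|j s IHs] lt_s /=; first by rewrite big_nil.
  rewrite rmorphD big_cons PoszD IHn ?IHs ?lt_s ?mem_head //.
  by move=> k ks; rewrite lt_s // inE ks orbT.
(* On a single column the count is evaluated from its definition, over the 24 orders of four
   cells. *)
have /allP/(_ i) : all (fun i => (state_count 0 i)%:Z == int_of_Z counts0`_i)
    (iota 0 (size states)).
  by vm_compute.
by rewrite mem_iota lt_i => /(_ isT)/eqP.
Qed.

(* The coefficients are those of the product of the two factors of the
   denominator. *)
Definition recurrence (R : pzRingType) (a : nat -> R) : R :=
  a 8 - 3 * a 7 - 3 * a 6 + 9 * a 5 + 6 * a 4 - 5 * a 3 - a 2 + 3 * a 1 - a 0.

(** The window covers two to ten columns. It cannot start at one column, since the numerator has a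
    nonzero coefficient at degree 9, one above the order of the recurrence. *)
Lemma counts_recurrence :
  let h := counts 1 in let table := traject next h 9 in
  all (fun i => recurrence (fun k => (nth h table k)`_i) == 0)
      (iota 0 (size states)).
Proof. by vm_compute. Qed.

Lemma recurrence_sum (R : comPzRingType) (I : Type) (s : seq I) (a : I -> nat -> R) :
  recurrence (fun k => \sum_(i <- s) a i k) = \sum_(i <- s) recurrence (a i).
Proof.
elim: s => [|i s IHs]; first by rewrite /recurrence !big_nil; ring.
by rewrite big_cons -IHs /recurrence !big_cons; ring.
Qed.

Lemma recurrence_rmorph (R R' : pzRingType) (f : {rmorphism R -> R'}) (a : nat -> R) :
  f (recurrence a) = recurrence (f \o a).
Proof.
by rewrite /recurrence !(rmorphB, rmorphD) !rmorphM !rmorph_nat.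
Qed.

Lemma eq_recurrence (R : pzRingType) (a b : nat -> R) :
  (forall k, (k < 9)%N -> a k = b k) -> recurrence a = recurrence b.
Proof. by move=> ab; rewrite /recurrence !ab. Qed.

(** Each sequence, advanced by one column, is a sum of sequences of the family; the recurrence is
    linear, so its vanishing for all states at [n] passes to [n.+1]. *)
Lemma state_count_recurrence n i : (i < size states)%N ->
  recurrence (fun k => (state_count (n + k.+1) i)%:Z) = 0.
Proof.
elim: n i => [|n IHn] i lt_i.
  have /allP/(_ i) := counts_recurrence.
  rewrite mem_iota lt_i => /(_ isT) /eqP/(congr1 int_of_Z).
  rewrite rmorph0 recurrence_rmorph => rec0; apply: etrans rec0.
  apply: eq_recurrence => k lt_k.
  by rewrite countsE // [RHS]/comp nth_traject // /counts add0n iterSr.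
transitivity (recurrence (fun k =>
    \sum_(j <- nth [::] transitions i) (state_count (n + k.+1) j)%:Z)).
  by apply: eq_recurrence => k _; rewrite addSn state_countS // raddf_sum.
rewrite recurrence_sum big_seq big1 // => j /(transitions_lt lt_i); exact: IHn.
Qed.

Definition init_index := Eval vm_compute in index init states.

Lemma greek_keyS n : greek_key 4 n.+1 = state_count n init_index.
Proof. by rewrite greek_keyE. Qed.

Lemma greek_key_recurrence n : recurrence (fun k => (greek_key 4 (n + k.+2))%:Z) = 0.
Proof.
rewrite -(@state_count_recurrence n init_index) //.
by apply: eq_recurrence => k _; rewrite addnS greek_keyS.
Qed.

(** * The generating function *)

Section Coefficients.
Variable R : comUnitRingType.
Implicit Types f : fps R.

Lemma coef_mulfX f n :
  fps_coef (f * fpsX R) n = if n is m.+1 then fps_coef f m else 0.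
Proof.
case: n => [|n] /=; first by rewrite big_ord_recl big_ord0 /= mulr0 addr0.
rewrite big_ord_recr /= subnn mulr0 addr0 big_ord_recr /= subSnn mulr1.
rewrite big1 ?add0r // => i _; rewrite subSn 1?ltnW // eqSS subn_eq0 leqNgt.
by rewrite ltn_ord mulr0.
Qed.

Lemma coef_mulfXn f m n : fps_coef (f * fpsX R ^+ m) n =
  if (n < m)%N then 0 else fps_coef f (n - m).
Proof.
elim: m n => [|m IHm] n; first by rewrite mulr1 subn0.
by rewrite exprSr mulrA coef_mulfX; case: n.
Qed.

Lemma coef_mulfn f m n : fps_coef (f *+ m) n = fps_coef f n *+ m.
Proof. by elim: m => [|m IHm]; rewrite ?mulr0n // !mulrS -IHm. Qed.

End Coefficients.

Lemma coefX_n (R : comUnitRingType) m n : fps_coef (fpsX R ^+ m) n = (n == m)%:R.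
Proof.
rewrite -[_ ^+ m]mul1r coef_mulfXn /= subn_eq0.
by case: ltngtP.
Qed.

Definition first_counts := Eval vm_compute in
  [seq (counts n)`_init_index | n <- iota 0 9].

Lemma greek_key_values :
  [seq (greek_key 4 n.+1)%:Z | n <- iota 0 9] = map int_of_Z first_counts.
Proof.
rewrite (_ : first_counts = [seq (counts n)`_init_index | n <- iota 0 9]).
  by rewrite -map_comp; apply: eq_map => n; rewrite /= greek_keyS countsE.
by apply/eqP; vm_compute.
Qed.

Theorem mainTheorem9 :
  let x : fps int := fpsX int in
  greek_key_gf 4 =
    (1 - 2 * x - 2 * x ^+ 2 + 11 * x ^+ 3 + 4 * x ^+ 4 - 10 * x ^+ 5
       + 4 * x ^+ 6 + 2 * x ^+ 7 - 3 * x ^+ 8 + x ^+ 9)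
    / ((1 - x - 3 * x ^+ 2 - x ^+ 3 + x ^+ 4)
       * (1 - 2 * x - 2 * x ^+ 2 + 2 * x ^+ 3 - x ^+ 4)).
Proof.
move=> x; set num := (X in X / _); set den := (X in _ / X).
set G := greek_key_gf 4.
have coefD (f g : fps int) n : fps_coef (f + g) n = fps_coef f n + fps_coef g n by [].
have coefN (f : fps int) n : fps_coef (- f) n = - fps_coef f n by [].
have coef1 n : fps_coef (1 : fps int) n = (n == 0)%:R by [].
pose coefE := (coef_mulfn, coef_mulfXn, coefX_n, coef1, coefN, coefD).
(* Both polynomials become integer multiples of powers of [x], the form to which the coefficient
   lemmas apply. *)
have denE : den = 1 - x ^+ 1 *+ 3 - x ^+ 2 *+ 3 + x ^+ 3 *+ 9 + x ^+ 4 *+ 6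
    - x ^+ 5 *+ 5 - x ^+ 6 + x ^+ 7 *+ 3 - x ^+ 8.
  by rewrite /den; ring.
have numE : num = 1 - x ^+ 1 *+ 2 - x ^+ 2 *+ 2 + x ^+ 3 *+ 11 + x ^+ 4 *+ 4
    - x ^+ 5 *+ 10 + x ^+ 6 *+ 4 + x ^+ 7 *+ 2 - x ^+ 8 *+ 3 + x ^+ 9.
  by rewrite /num; ring.
have den_unit : den \is a GRing.unit.
  suff den0 : fps_coef den 0 = 1.
    by change (fps_unit den); rewrite /fps_unit den0 unitr1.
  by rewrite denE !coefE.
suff GdenE : G * den = num by rewrite -GdenE mulrK.
have -> : G * den = G - G * x ^+ 1 *+ 3 - G * x ^+ 2 *+ 3 + G * x ^+ 3 *+ 9
    + G * x ^+ 4 *+ 6 - G * x ^+ 5 *+ 5 - G * x ^+ 6 + G * x ^+ 7 *+ 3 - G * x ^+ 8.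
  by rewrite denE; ring.
have coefG k : fps_coef G k = (greek_key 4 k)%:Z by [].
rewrite numE; apply: fpsP => n; rewrite !coefE !coefG.
have S0 k : (k.+1 == 0) = false by [].
have O0 k : (0 == k.+1)%N = false by [].
pose natE := (ltnS, ltn0, leq0n, subSS, subn0, eqSS, S0, O0, eqxx).
have g0 : greek_key 4 0 = 1%N by [].
have := greek_key_values; case=> g1 g2 g3 g4 g5 g6 g7 g8 g9.
(* Coefficients 0 to 9 are compared numerically, using the convention at 0 and the nine computed
   values; from 10 on the recurrence makes the coefficient of [G * den] vanish. *)
do 10?[case: n => [|n]]; last first.
  have := greek_key_recurrence n; rewrite /recurrence !addnS !addn0 !natE.
  lia.
all: rewrite !natE ?g0 ?g1 ?g2 ?g3 ?g4 ?g5 ?g6 ?g7 ?g8 ?g9; lia.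
Qed.
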